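(* Let $n\geq 1$ be an integer. There exists a unique $\pi_n\in L(\mathbb{Z})=t+t^2\mathbb{Z}[[t]]$ such that for every $\lambda$-ring $R$, every $n$-Pfister element of $R$ has $\pi_n$-dimension at most $1$. Explicitly, $$\pi_n=1-\frac{2}{1+(1+2^nt)^{\frac{1}{2^{n-1}}}},$$ and one has, for $n\geq 1$, $$\pi_{n+1}=\pi_n\circ\bigl(tC(-2^{n-1}t)\bigr),\qquad \pi_n=\pi_{n+1}\circ\bigl(t+2^{n-1}t^2\bigr),$$ where $C(t)=\frac{1-\sqrt{1-4t}}{2t}$ is the generating series of the Catalan numbers.
   Context: For a commutative ring $R$, $L(R)=t+t^2R[[t]]$. A $\lambda$-ring is meant in the usual strong sense (also called special $\lambda$-ring): a commutative ring $R$ with operations $\lambda^d$ ($d\geq 0$), $\lambda_t(x)=\sum_d\lambda^d(x)t^d$, with $\lambda^0(x)=1$, $\lambda^1(x)=x$, $\lambda_t(x+y)=\lambda_t(x)\lambda_t(y)$, $\lambda_t(1)=1+t$, and satisfying the universal polynomial identities for $\lambda^d(xy)$ and $\lambda^m(\lambda^n(x))$. For $\alpha\in L(R)$ (or $\alpha\in L(\mathbb{Z})$, mapped to $L(R)$) define operations $\alpha^d:R\to R$ by $\alpha_t(x)=\sum_d\alpha^d(x)t^d:=\lambda_{\alpha(t)}(x)$, i.e. substitute $\alpha(t)$ for $t$ in $\lambda_t(x)$. The $\alpha$-dimension of $x$ is the degree in $t$ (possibly infinite) of $\alpha_t(x)$; thus $\alpha$-dimension at most $1$ means $\alpha_t(x)=1+xt$.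 A Pfister element of $R$ is an element $x$ with $x^2=2x$ and $\lambda^d(x)=x$ for all $d\geq1$; an $n$-Pfister element is a product of $n$ Pfister elements. The fractional power $(1+2^nt)^{1/2^{n-1}}$ denotes the binomial power series with constant term $1$. *)

(* Defs.v *)
From HB Require Import structures.
From mathcomp Require Import all_boot all_order all_algebra.
From mathcomp Require Import mpoly.

Set Implicit Arguments.
Unset Strict Implicit.
Unset Printing Implicit Defensive.

Import GRing.Theory.
Local Open Scope ring_scope.

(* Formal power series, as coefficient sequences.  Every operation below is
   named explicitly; the pointwise algebraic structures that exist on function
   types are never used.  Series are compared with =1, coefficientwise. *)

Definition fps (R : Type) : Type := nat -> R.

Declare Scope fps_scope.
Delimit Scope fps_scope with fps.
Bind Scope fps_scope with fps.

Section Fps.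
Variable R : pzRingType.
Implicit Types f g : fps R.

Definition fps_const (c : R) : fps R := fun k => if k == 0%N then c else 0.
Definition fps_X : fps R := fun k => if k == 1%N then 1 else 0.
Definition fps_add f g : fps R := fun k => f k + g k.
Definition fps_sub f g : fps R := fun k => f k - g k.
Definition fps_mul f g : fps R := fun k => \sum_(i < k.+1) f i * g (k - i)%N.
Definition fps_exp f (d : nat) : fps R := iter d (fps_mul f) (fps_const 1).

(* f(g(t)); only meaningful when g has zero constant term, in which case
   g^d has no term of degree < d and the sum may stop at d = k. *)
Definition fps_comp f g : fps R :=
  fun k => \sum_(d < k.+1) f d * fps_exp g d k.

End Fps.

Arguments fps_X {R}.

Notation "c %:S" := (fps_const c) (at level 2, format "c %:S") : fps_scope.
Notation "f + g" := (fps_add f g) : fps_scope.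
Notation "f - g" := (fps_sub f g) : fps_scope.
Notation "f * g" := (fps_mul f g) : fps_scope.
Notation "f ^+ d" := (fps_exp f d) : fps_scope.

Definition fps_map (R S : Type) (h : R -> S) (f : fps R) : fps S :=
  fun k => h (f k).

(* 1 / f for f with invertible constant term u, as the geometric series
   u^-1 * \sum_d (1 - f / u)^d. *)
Definition fps_inv (K : fieldType) (f : fps K) : fps K :=
  ((f 0%N)^-1%:S *
   fps_comp (fun _ => 1%R) (1%:S - (f 0%N)^-1%:S * f))%fps.

(* (1 + t) ^ a for a rational exponent a. *)
Definition binomial_series (a : rat) : fps rat :=
  fun k => (\prod_(i < k) (a - i%:R)) / (k`!)%:R.

(* (1 + c t) ^ a *)
Definition fps_binpow (c a : rat) : fps rat :=
  fps_comp (binomial_series a) (c%:S * fps_X)%fps.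

Definition catalan_series : fps int := fun k => ('C(k.*2, k) %/ k.+1)%N%:Z.

(* L(R) = t + t^2 R[[t]] *)
Definition in_L (R : pzRingType) (f : fps R) : Prop := f 0%N = 0 /\ f 1%N = 1.

(* Value at v of a polynomial with integer coefficients.  This is
   mmap intr v P, except that mmap does not allow the zero ring as target. *)
Definition evalZ (A : comPzRingType) (N : nat) (P : {mpoly int[N]})
    (v : 'I_N -> A) : A :=
  \sum_(m <- msupp P) (P@_m)%:~R * \prod_(i < N) v i ^+ m i.

Definition join_fun (A : Type) (d : nat) (u v : 'I_d -> A)
    (k : 'I_(d + d)) : A :=
  match split k with inl i => u i | inr j => v j end.

(* P(e_1(x), ..., e_d(x); e_1(y), ..., e_d(y)) is the coefficient of t^d in
   \prod_(i, j) (1 + x_i y_j t), for variables x_1, ..., x_d, y_1, ..., y_d. *)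
Definition product_poly (d : nat) (P : {mpoly int[d + d]}) : Prop :=
  let x (i : 'I_d) : {mpoly int[d + d]} := 'X_(lshift d i) in
  let y (j : 'I_d) : {mpoly int[d + d]} := 'X_(rshift d j) in
  evalZ P (join_fun (fun i : 'I_d => (mesym d {mpoly int[d + d]} i.+1).@[x])
                    (fun j : 'I_d => (mesym d {mpoly int[d + d]} j.+1).@[y]))
  = (\prod_(i < d) \prod_(j < d) (1 + (x i * y j) *: 'X))`_d.

(* P(e_1(x), ..., e_mn(x)) is the coefficient of t^m in the product of the
   1 + x_{i_1} ... x_{i_n} t over i_1 < ... < i_n, for variables
   x_1, ..., x_mn. *)
Definition composition_poly (m n : nat) (P : {mpoly int[m * n]}) : Prop :=
  let x (i : 'I_(m * n)) : {mpoly int[m * n]} := 'X_i in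
  evalZ P (fun i : 'I_(m * n) => mesym (m * n) int i.+1)
  = (\prod_(S : {set 'I_(m * n)} | #|S| == n)
       (1 + (\prod_(i in S) x i) *: 'X))`_m.

(* lam d is the operation lambda^d.  The universal polynomials exist and are
   unique by the fundamental theorem on symmetric polynomials. *)
Record lambda_ring (R : comPzRingType) (lam : nat -> R -> R) : Prop :=
  LambdaRing {
    lam0 : forall x, lam 0%N x = 1;
    lam1 : forall x, lam 1%N x = x;
    lamD : forall d x y,
      lam d (x + y) = \sum_(i < d.+1) lam i x * lam (d - i)%N y;
    lam_one : forall d, (1 < d)%N -> lam d 1 = 0;
    lamM : forall d, exists2 P, product_poly P &
      forall x y, lam d (x * y) =
        evalZ P (join_fun (fun i : 'I_d => lam i.+1 x)
                          (fun j : 'I_d => lam j.+1 y));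
    lam_lam : forall m n, exists2 P, @composition_poly m n P &
      forall x, lam m (lam n x) =
        evalZ P (fun i : 'I_(m * n) => lam i.+1 x)
  }.

Section LambdaOps.
Variables (R : comPzRingType) (lam : nat -> R -> R).

(* alpha_t(x) = lambda_{alpha(t)}(x), as a series in t; its k-th coefficient
   is alpha^k(x). *)
Definition alpha_t (alpha : fps R) (x : R) : fps R :=
  fps_comp (fun d => lam d x) alpha.

Definition alpha_dim_le (alpha : fps R) (x : R) (m : nat) : Prop :=
  forall k, (m < k)%N -> alpha_t alpha x k = 0.

Definition pfister (x : R) : Prop :=
  x ^+ 2 = x *+ 2 /\ forall d, (0 < d)%N -> lam d x = x.

Definition n_pfister (n : nat) (x : R) : Prop :=
  exists2 a : 'I_n -> R, forall i, pfister (a i) & x = \prod_(i < n) a i.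

End LambdaOps.

Definition pfister_dim_le1 (n : nat) (alpha : fps int) : Prop :=
  forall (R : comPzRingType) (lam : nat -> R -> R), lambda_ring lam ->
  forall x : R, n_pfister lam n x ->
    alpha_dim_le lam (fps_map intr alpha) x 1.

(* Main.v *)
From HB Require Import structures.
From mathcomp Require Import all_boot all_order all_fingroup all_algebra.
From mathcomp Require Import mpoly ring.
From mathcomp Require boolp.
From mathcomp Require Import algC.
Require Import Defs.

Set Implicit Arguments.
Unset Strict Implicit.
Unset Printing Implicit Defensive.

Import GRing.Theory Num.Theory.
Local Open Scope ring_scope.

(** Let g_n be the integral series with
    1 + 2^n g_n = ((1 + t)/(1 - t))^(2^(n-1)); below, series of level n >= 1
    carry the index m = n - 1.  The point is that lambda_t(x) = 1 + x g_n(t) for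
    every n-Pfister element x of every lambda-ring ([lambda_pfister_prod]).
    Hence alpha_t(x) = 1 + x g_n(alpha(t)), and alpha = pi_n works as soon as
    pi_n is the compositional inverse of g_n.  Since
    1 + 2^(n+1) g_(n+1) = (1 + 2^n g_n)^2, one has g_(n+1) = q_n o g_n with
    q_n = t + 2^(n-1) t^2, whose inverse is t C(-2^(n-1) t) by the equation
    C = 1 + t C^2; this gives pi_n and both relations between pi_n and
    pi_(n+1).  Solving 1 + 2^n t = ((1 + pi_n)/(1 - pi_n))^(2^(n-1)) gives the
    explicit form.

    Everything about lambda-operations goes through power sums.  In
    characteristic 0 a series E with constant term 1 and its power sums p_k
    determine each other by Newton's identities, and over algebraically closed
    fields arbitrary p_1, ..., p_d are the power sums of d numbers
    ([power_sums_split]).  Any polynomial identity that defines the universal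
    polynomials can therefore be evaluated at arbitrary power sums: products
    multiply power sums ([product_poly_esym]), and lambda^m o lambda^n is
    governed by p_(jk) ([composition_poly_esym]).  The lambda-operations of a
    product x y, with x Pfister and y an n-Pfister element, lie in the span of
    1, x, y, xy with integral coefficients that do not depend on the ring, so
    these coefficients can be read off over the complex algebraic numbers
    ([product_poly_pfister]).

    Uniqueness requires one lambda-ring with an n-Pfister element that is not
    torsion: a product of two copies of the complex algebraic numbers, with the
    Adams operations of the representation ring of a group of order two
    ([lambda2_ring]).  There alpha_t(x) = 1 + xt forces g_n o alpha = t. *)

(** * The ring of power series *)

(* Extensionality makes the coefficientwise comparison of series an equality,
   so that they form a commutative ring. *)

HB.instance Definition _ (A : Type) := boolp.gen_eqMixin (fps A).
HB.instance Definition _ (A : Type) := boolp.gen_choiceMixin (fps A).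

Lemma fpsP (A : Type) (f g : fps A) : f =1 g -> f = g.
Proof. by move=> fg; apply: boolp.funext. Qed.

Section SeriesRing.
Variable A : comNzRingType.
Implicit Types (f g h : fps A) (c : A).

Definition fps_opp f : fps A := fun k => - f k.

Lemma fps_addA : associative (@fps_add A).
Proof. by move=> f g h; apply: fpsP => k; apply: addrA. Qed.
Lemma fps_addC : commutative (@fps_add A).
Proof. by move=> f g; apply: fpsP => k; apply: addrC. Qed.
Lemma fps_add0 : left_id (fps_const 0) (@fps_add A).
Proof.
by move=> f; apply: fpsP => k; rewrite /fps_add /fps_const if_same add0r.
Qed.
Lemma fps_addN : left_inverse (fps_const 0) fps_opp (@fps_add A).
Proof.
move=> f; apply: fpsP => k; rewrite /fps_add /fps_const if_same.
exact: addNr.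
Qed.

HB.instance Definition _ := GRing.isZmodule.Build (fps A)
  fps_addA fps_addC fps_add0 fps_addN.

Lemma fps_mulC : commutative (@fps_mul A).
Proof.
move=> f g; apply: fpsP => k; rewrite /fps_mul (reindex_inj rev_ord_inj) /=.
by apply: eq_bigr => i _; rewrite subSS mulrC subKn // -ltnS.
Qed.

(** Up to degree k, products of series are products of truncated polynomials. *)
Lemma fps_mulA : associative (@fps_mul A).
Proof.
move=> f g h; apply: fpsP => k.
pose T (u : fps A) : {poly A} := \poly_(i < k.+1) u i.
have TE u i : (i <= k)%N -> (T u)`_i = u i by rewrite coef_poly ltnS => ->.
have TM u v i : (i <= k)%N -> fps_mul u v i = (T u * T v)`_i.
  move=> le_ik; rewrite coefM; apply: eq_bigr => j _.
  have le_ji : (j <= i)%N by rewrite -ltnS.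
  by rewrite !TE // (leq_trans _ le_ik) // leq_subr.
have -> : fps_mul f (fps_mul g h) k = (T f * (T g * T h))`_k.
  rewrite coefM; apply: eq_bigr => i _.
  by rewrite TE ?TM ?leq_subr // -ltnS.
have -> : fps_mul (fps_mul f g) h k = (T f * T g * T h)`_k.
  rewrite coefM; apply: eq_bigr => i _.
  by rewrite (TE h) ?leq_subr // TM // -ltnS.
by rewrite mulrA.
Qed.

Lemma fps_mul1 : left_id (fps_const 1) (@fps_mul A).
Proof.
move=> f; apply: fpsP => k; rewrite /fps_mul big_ord_recl /= mul1r subn0.
by rewrite big1 ?addr0 // => i _; rewrite /fps_const /= mul0r.
Qed.
Lemma fps_mulDl : left_distributive (@fps_mul A) (@fps_add A).
Proof.
move=> f g h; apply: fpsP => k; rewrite /fps_mul /fps_add -big_split.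
by apply: eq_bigr => i _; rewrite mulrDl.
Qed.
Lemma fps_1neq0 : fps_const (1 : A) != fps_const 0.
Proof.
apply/eqP => /(congr1 (fun f => f 0%N)) /eqP.
by rewrite /fps_const /= oner_eq0.
Qed.

HB.instance Definition _ := GRing.Zmodule_isComNzRing.Build (fps A)
  fps_mulA fps_mulC fps_mul1 fps_mulDl fps_1neq0.

Lemma fps_coef0 k : (0 : fps A) k = 0.
Proof. by rewrite -[0]/(@fps_const A 0) /fps_const if_same. Qed.
Lemma fps_coef1 k : (1 : fps A) k = (k == 0%N)%:R.
Proof. by rewrite -[1]/(@fps_const A 1) /fps_const; case: eqP. Qed.
Lemma fps_coefD f g k : (f + g) k = f k + g k. Proof. by []. Qed.
Lemma fps_coefN f k : (- f) k = - f k. Proof. by []. Qed.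
Lemma fps_coefB f g k : (f - g) k = f k - g k. Proof. by []. Qed.
Lemma fps_coefM f g k : (f * g) k = \sum_(i < k.+1) f i * g (k - i)%N.
Proof. by []. Qed.
Lemma fps_coef_sum (I : Type) (r : seq I) (P : pred I) (F : I -> fps A) k :
  (\sum_(i <- r | P i) F i) k = \sum_(i <- r | P i) F i k.
Proof.
by elim/big_rec2: _ => [|i y1 y2 _ <-]; rewrite ?fps_coef0 // fps_coefD.
Qed.
Lemma fps_coefM0 f g : (f * g) 0%N = f 0%N * g 0%N.
Proof. by rewrite fps_coefM big_ord1. Qed.
Lemma fps_coefMn f n k : (f *+ n) k = f k *+ n.
Proof.
elim: n => [|n IHn]; first by rewrite !mulr0n fps_coef0.
by rewrite !mulrS fps_coefD IHn.
Qed.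

Lemma fps_expE f n : fps_exp f n = f ^+ n.
Proof. by elim: n => //= n IHn; rewrite exprS -IHn. Qed.

Lemma fps_const1 : fps_const 1 = 1 :> fps A. Proof. by []. Qed.
Lemma fps_constMn n : fps_const n%:R = n%:R :> fps A.
Proof.
by apply: fpsP => k; rewrite fps_coefMn fps_coef1 /fps_const; case: eqP;
  rewrite ?mul0rn.
Qed.
Lemma fps_coefCM c f k : (fps_const c * f) k = c * f k.
Proof.
rewrite fps_coefM big_ord_recl /= subn0 big1 ?addr0 // => i _.
by rewrite /fps_const /= mul0r.
Qed.
Lemma fps_constM c d : fps_const (c * d) = fps_const c * fps_const d.
Proof.
by apply: fpsP => k; rewrite fps_coefCM /fps_const; case: eqP; rewrite ?mulr0.
Qed.
Lemma fps_coefXM f k : (fps_X * f) k = if k is k'.+1 then f k' else 0.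
Proof.
case: k => [|k]; rewrite fps_coefM ?big_ord1 /fps_X /= ?mul0r //.
rewrite !big_ord_recl /= mul0r mul1r add0r subSS subn0 big1 ?addr0 // => i _.
by rewrite mul0r.
Qed.

Lemma fps_coefX_ge f : f 0%N = 0 -> forall d k, (k < d)%N -> (f ^+ d) k = 0.
Proof.
move=> f0; elim=> // d IHd k lt_kd; rewrite exprS fps_coefM big_ord_recl.
rewrite f0 mul0r add0r big1 // => i _; rewrite IHd ?mulr0 //=.
rewrite /bump leq0n add1n; case: k lt_kd i => [|k] lt_kd [i lt_ik] //=.
by rewrite subSS (leq_ltn_trans (leq_subr _ _)).
Qed.

Lemma fps_coefXn d k : (fps_X ^+ d : fps A) k = (k == d)%:R.
Proof.
elim: d k => [|d IHd] k; first exact: fps_coef1.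
by rewrite exprS fps_coefXM; case: k => //= k; rewrite IHd.
Qed.
Lemma fps_coefXn0 f n : (f ^+ n) 0%N = f 0%N ^+ n.
Proof.
by elim: n => [|n IHn]; rewrite ?expr0 ?fps_coef1 // !exprS fps_coefM0 IHn.
Qed.
Lemma fps_constXn c n : fps_const c ^+ n = fps_const (c ^+ n).
Proof. by elim: n => // n IHn; rewrite !exprS IHn fps_constM. Qed.
Lemma fps_XI f g : fps_X * f = fps_X * g -> f = g.
Proof.
move=> eq_fg; apply: fpsP => k.
by have := congr1 (fun h => h k.+1) eq_fg; rewrite !fps_coefXM.
Qed.

End SeriesRing.

Lemma fps_mulfI (A : idomainType) (f g : fps A) :
  f 0%N != 0 -> f * g = 0 -> g = 0.
Proof.
move=> f0 fg0; apply: fpsP => k; rewrite fps_coef0.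
have [n] := ubnP k; elim: n k => // n IHn k; rewrite ltnS => le_kn.
have := congr1 (fun h => h k) fg0; rewrite fps_coef0 fps_coefM big_ord_recl.
rewrite subn0 big1 ?addr0 => [/eqP|i _]; last first.
  rewrite IHn ?mulr0 // lift0; case: k i le_kn => [[]//|k] i le_kn.
  by rewrite subSS (leq_ltn_trans (leq_subr _ _)).
by rewrite mulf_eq0 (negbTE f0) => /eqP.
Qed.

(** * Composition of power series *)

Section Composition.
Variable A : comNzRingType.
Implicit Types (f g h : fps A) (c : A).

Lemma fps_comp_coef f g k :
  fps_comp f g k = \sum_(d < k.+1) f d * (g ^+ d) k.
Proof. by apply: eq_bigr => d _; rewrite fps_expE. Qed.

Lemma fps_compE f g N k : g 0%N = 0 -> (k < N)%N ->
  fps_comp f g k = \sum_(d < N) f d * (g ^+ d) k.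
Proof.
move=> g0 lt_kN; rewrite fps_comp_coef.
rewrite (big_ord_widen N (fun d => f d * (g ^+ d) k) lt_kN) big_mkcond.
apply: eq_bigr => d _; case: ifP => // /negbT; rewrite -leqNgt => lt_kd.
by rewrite fps_coefX_ge ?mulr0.
Qed.

Lemma fps_comp_coef0 f g : fps_comp f g 0%N = f 0%N.
Proof. by rewrite fps_comp_coef big_ord1 /= /fps_const /= mulr1. Qed.

Lemma fps_comp_coef1 f g : fps_comp f g 1%N = f 1%N * g 1%N.
Proof.
by rewrite fps_comp_coef !big_ord_recl big_ord0 !expr0 expr1 fps_coef1 mulr0
  add0r addr0.
Qed.

(* Arguments of fps operations are read in fps_scope; %R selects the operations
   of the ring structure. *)
Lemma fps_compD f1 f2 g :
  fps_comp (f1 + f2)%R g = fps_comp f1 g + fps_comp f2 g.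
Proof.
apply: fpsP => k; rewrite fps_coefD !fps_comp_coef -big_split.
by apply: eq_bigr => d _; rewrite fps_coefD mulrDl.
Qed.

Lemma fps_compN f g : fps_comp (- f)%R g = - fps_comp f g.
Proof.
apply: fpsP => k; rewrite fps_coefN !fps_comp_coef -sumrN.
by apply: eq_bigr => d _; rewrite fps_coefN mulNr.
Qed.

Lemma fps_compB f1 f2 g :
  fps_comp (f1 - f2)%R g = fps_comp f1 g - fps_comp f2 g.
Proof. by rewrite fps_compD fps_compN. Qed.

Lemma fps_compC c g : fps_comp (fps_const c) g = fps_const c.
Proof.
apply: fpsP => k; rewrite fps_comp_coef big_ord_recl big1 => [|d _].
  by rewrite addr0 expr0 fps_coef1 /fps_const /=; case: eqP;
    rewrite ?mulr1 ?mulr0.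
by rewrite {1}/fps_const mul0r.
Qed.

Lemma fps_comp1 g : fps_comp 1 g = 1.
Proof. exact: fps_compC. Qed.

(** Only the pairs a + b <= k contribute to the coefficient of t^k, because
   g^(a + b) is divisible by t^(a + b). *)
Lemma fps_compM f1 f2 g : g 0%N = 0 ->
  fps_comp (f1 * f2)%R g = fps_comp f1 g * fps_comp f2 g.
Proof.
move=> g0; apply: fpsP => k.
pose F a b := f1 a * f2 b * (g ^+ (a + b)) k.
transitivity (\sum_(a < k.+1) \sum_(b < k.+1) F a b); last first.
  rewrite fps_coefM.
  transitivity (\sum_(i < k.+1) \sum_(a < k.+1) \sum_(b < k.+1)
      f1 a * f2 b * ((g ^+ a) i * (g ^+ b) (k - i)%N)).
    rewrite [RHS]exchange_big; apply: eq_bigr => a _.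
    rewrite [RHS]exchange_big; apply: eq_bigr => b _.
    by rewrite -mulr_sumr /F exprD fps_coefM.
  apply: eq_bigr => i _.
  rewrite (fps_compE f1 g0 (ltn_ord i)).
  rewrite (@fps_compE f2 g k.+1) ?ltnS ?leq_subr //.
  rewrite big_distrlr; apply: eq_bigr => a _; apply: eq_bigr => b _.
  by rewrite mulrACA.
rewrite fps_comp_coef.
transitivity (\sum_(d < k.+1) \sum_(a < k.+1 | (a <= d)%N) F a (d - a)%N).
  apply: eq_bigr => d _; rewrite fps_coefM mulr_suml.
  rewrite (big_ord_widen k.+1 (fun a => f1 a * f2 (d - a)%N * (g ^+ d) k)) //.
  by apply: eq_big => // a; rewrite ltnS => le_ad; rewrite /F subnKC.
rewrite (exchange_big_dep predT) //=; apply: eq_bigr => a _.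
have le_ak : (a <= k)%N by rewrite -ltnS.
rewrite -(big_mkord (fun d => (a <= d)%N) (fun d => F a (d - a)%N)).
rewrite (@big_cat_nat _ _ _ a) //= ?(leqW le_ak) // big_nat_cond big1 ?add0r;
  last first.
  by move=> d /andP[/andP[_ lt_da]]; rewrite leqNgt lt_da.
rewrite big_nat_cond (eq_bigl (fun d => a <= d < k.+1)%N); last first.
  by move=> d; case: (a <= d)%N; rewrite ?andbT ?andbF.
rewrite -big_nat -{1}[val a]add0n big_addn big_mkord.
transitivity (\sum_(b < k.+1 - a) F a b).
  by apply: eq_bigr => b _; congr (F _ _); exact: addnK.
rewrite (big_ord_widen k.+1 (F a)) ?leq_subr // big_mkcond.
apply: eq_bigr => b _; case: ifP => // /negbT;
  rewrite -leqNgt leq_subLR => lt_k.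
by rewrite /F fps_coefX_ge ?mulr0.
Qed.

Lemma fps_compXn f g n : g 0%N = 0 -> fps_comp (f ^+ n)%R g = fps_comp f g ^+ n.
Proof.
move=> g0; elim: n => [|n IHn]; first exact: fps_comp1.
by rewrite !exprS fps_compM // IHn.
Qed.

Lemma fps_compX f : fps_comp f fps_X = f.
Proof.
apply: fpsP => k; rewrite fps_comp_coef (bigD1 ord_max) //= fps_coefXn eqxx
  mulr1.
rewrite big1 ?addr0 // => d; rewrite -val_eqE eq_sym /= => /negbTE neq_dk.
by rewrite fps_coefXn neq_dk mulr0.
Qed.

Lemma fps_compXl g : g 0%N = 0 -> fps_comp fps_X g = g.
Proof.
move=> g0; apply: fpsP => k; rewrite (@fps_compE _ _ k.+2) //.
rewrite !big_ord_recl /= /fps_X /= mul0r mul1r add0r expr1.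
by rewrite big1 ?addr0 // => i _; rewrite mul0r.
Qed.

Lemma fps_compA f g h : g 0%N = 0 -> h 0%N = 0 ->
  fps_comp f (fps_comp g h) = fps_comp (fps_comp f g) h.
Proof.
move=> g0 h0; apply: fpsP => k; rewrite [RHS]fps_comp_coef.
rewrite [LHS](@fps_compE _ _ k.+1) ?fps_comp_coef0 //.
transitivity (\sum_(d < k.+1) \sum_(a < k.+1) f a * (g ^+ a) d * (h ^+ d) k).
  rewrite exchange_big; apply: eq_bigr => a _.
  rewrite -fps_compXn // fps_comp_coef mulr_sumr; apply: eq_bigr => d _.
  by rewrite mulrA.
apply: eq_bigr => d _; rewrite -mulr_suml; congr (_ * _).
by rewrite (fps_compE f g0 (ltn_ord d)).
Qed.

End Composition.

Section MapSeries.
Variables (A B : comNzRingType) (u : {rmorphism A -> B}).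
Implicit Types f g : fps A.

Lemma fps_mapM f g : fps_map u (f * g)%R = fps_map u f * fps_map u g.
Proof.
by apply: fpsP => k; rewrite /fps_map !fps_coefM rmorph_sum;
  apply: eq_bigr => i _; rewrite rmorphM.
Qed.
Lemma fps_mapD f g : fps_map u (f + g)%R = fps_map u f + fps_map u g.
Proof. by apply: fpsP => k; rewrite /fps_map !fps_coefD raddfD. Qed.
Lemma fps_mapB f g : fps_map u (f - g)%R = fps_map u f - fps_map u g.
Proof. by apply: fpsP => k; rewrite /fps_map !fps_coefB raddfB. Qed.
Lemma fps_mapC c : fps_map u (fps_const c) = fps_const (u c).
Proof.
by apply: fpsP => k; rewrite /fps_map /fps_const; case: eqP; rewrite ?raddf0.
Qed.
Lemma fps_map1 : fps_map u 1 = 1.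
Proof. by rewrite -!fps_const1 fps_mapC rmorph1. Qed.
Lemma fps_mapX : fps_map u fps_X = fps_X.
Proof.
apply: fpsP => k; rewrite /fps_map /fps_X.
by case: eqP; rewrite ?raddf0 ?rmorph1.
Qed.
Lemma fps_mapXn f n : fps_map u (f ^+ n)%R = fps_map u f ^+ n.
Proof. by elim: n => [|n IHn]; rewrite ?fps_map1 // !exprS fps_mapM IHn. Qed.

End MapSeries.

(** * Logarithmic derivatives and power sums *)

Section LogDerivative.
Variable A : comNzRingType.
Implicit Types (E F P Q : fps A) (p q : nat -> A).

(** The Euler operator t d/dt, a derivation that preserves degrees. *)
Definition theta E : fps A := fun k => E k *+ k.

Lemma thetaM E F : theta (E * F)%R = theta E * F + E * theta F.
Proof.
apply: fpsP => k; rewrite {1}/theta fps_coefD !fps_coefM -big_split -sumrMnl.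
apply: eq_bigr => i _; rewrite /theta.
by rewrite /= mulrnAl mulrnAr -mulrnDr subnKC // -ltnS.
Qed.

(** P = t E'/E, the logarithmic derivative. *)
Definition logder E P := E 0%N = 1 /\ theta E = E * P.

Lemma logder_coef0 E P : logder E P -> P 0%N = 0.
Proof.
case=> E0 /(congr1 (fun f => f 0%N)).
by rewrite fps_coefM0 E0 mul1r /theta mulr0n.
Qed.

Lemma logder_rec E P k : logder E P ->
  E k *+ k = \sum_(i < k) E i * P (k - i)%N.
Proof.
move=> EP; have [_ /(congr1 (fun f => f k))] := EP.
rewrite fps_coefM big_ord_recr /= subnn (logder_coef0 EP) mulr0 addr0.
by [].
Qed.

Lemma logder1 : logder 1 0.
Proof.
split; first by rewrite fps_coef1.
by apply: fpsP => k; rewrite mulr0 fps_coef0 /theta fps_coef1;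
  case: k => //= k; rewrite mul0rn.
Qed.

Lemma logderM E F P Q : logder E P -> logder F Q -> logder (E * F)%R (P + Q)%R.
Proof.
move=> [E0 EP] [F0 FQ]; split; first by rewrite fps_coefM0 E0 F0 mulr1.
by rewrite thetaM EP FQ; ring.
Qed.

Lemma logder_prod (I : Type) (r : seq I) (C : pred I) (E P : I -> fps A) :
  (forall i, logder (E i) (P i)) ->
  logder (\prod_(i <- r | C i) E i) (\sum_(i <- r | C i) P i).
Proof.
move=> EP; elim/big_rec2: _ => [|i P' E' _ IH]; first exact: logder1.
exact: logderM.
Qed.

Lemma logderXn E P n : logder E P -> logder (E ^+ n)%R (P *+ n)%R.
Proof.
move=> EP; elim: n => [|n IHn]; first exact: logder1.
by rewrite exprS mulrS; apply: logderM.
Qed.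

(** By Newton's identities, the logarithmic derivative of the generating series
    of the elementary symmetric functions, in terms of the power sums. *)
Definition newton_series p : fps A :=
  fun k => if k is k'.+1 then (-1) ^+ k' * p k else 0.

Lemma newton_series_sum (I : Type) (r : seq I) (C : pred I)
    (p : I -> nat -> A) :
  \sum_(i <- r | C i) newton_series (p i) =
  newton_series (fun k => \sum_(i <- r | C i) p i k).
Proof.
apply: fpsP => -[|k]; rewrite fps_coef_sum /=; first by rewrite big1.
by rewrite mulr_sumr.
Qed.

Lemma line_newton a :
  (1 + fps_const a * fps_X) * newton_series (fun k => a ^+ k)
  = fps_const a * fps_X.
Proof.
apply: fpsP => k; rewrite mulrDl mul1r -mulrA fps_coefD !fps_coefCM fps_coefXM.
rewrite /fps_X; case: k => [|[|k]] /=; rewrite ?mulr0 ?addr0 ?mul1r ?mulr1 //.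
by rewrite -/(a ^+ k.+2) !exprS; ring.
Qed.

Lemma logder_line a :
  logder (1 + fps_const a * fps_X)%R (newton_series (fun k => a ^+ k)).
Proof.
split; first by rewrite fps_coefD fps_coefCM fps_coef1 /fps_X mulr0 addr0.
rewrite line_newton; apply: fpsP => k; rewrite /theta fps_coefD fps_coefCM.
rewrite fps_coef1 /fps_X; case: k => [|[|k]] //=;
  rewrite ?mulr0 ?add0r ?mul0rn //.
Qed.

Lemma logder_eq_der E F P Q d : logder E P -> logder F Q ->
  (forall k, (k <= d)%N -> E k = F k) -> forall k, (k <= d)%N -> P k = Q k.
Proof.
move=> EP FQ eqEF k; have [n] := ubnP k; elim: n k => // n IHn k.
rewrite ltnS => le_kn le_kd; case: k => [|k] in le_kn le_kd *.
  by rewrite (logder_coef0 EP) (logder_coef0 FQ).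
have := logder_rec k.+1 EP; rewrite eqEF // (logder_rec k.+1 FQ).
rewrite !big_ord_recl !subn0 (proj1 EP) (proj1 FQ) !mul1r => eqPQ.
apply/esym; move: eqPQ; set S1 := \sum_(i < k) _; set S2 := \sum_(i < k) _.
have -> : S1 = S2; last exact: addIr.
apply: eq_bigr => i _; rewrite lift0 subSS.
have le_ik : (k - i <= k)%N by exact: leq_subr.
rewrite eqEF ?IHn //; first exact: leq_ltn_trans le_ik le_kn.
  exact: leq_trans le_ik (ltnW le_kd).
exact: leq_trans (ltn_ord i) (ltnW le_kd).
Qed.

End LogDerivative.

Section PowerSums.
Variable K : numFieldType.
Implicit Types (E F P : fps K) (p q : nat -> K).

Lemma logder_eq E F P Q d : logder E P -> logder F Q ->
  (forall k, (k <= d)%N -> P k = Q k) -> forall k, (k <= d)%N -> E k = F k.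
Proof.
move=> EP FQ eqPQ k; have [n] := ubnP k; elim: n k => // n IHn k.
rewrite ltnS => le_kn le_kd; case: k => [|k] in le_kn le_kd *.
  by rewrite (proj1 EP) (proj1 FQ).
apply: (@mulIf _ k.+1%:R); first by rewrite pnatr_eq0.
rewrite !mulr_natr (logder_rec _ EP) (logder_rec _ FQ).
apply: eq_bigr => i _; rewrite eqPQ ?IHn //.
- exact: leq_trans (ltn_ord i) _.
- exact: leq_trans (ltnW (ltn_ord i)) _.
- exact: leq_trans (leq_subr _ _) _.
Qed.

Lemma logder_uniq E F P : logder E P -> logder F P -> E = F.
Proof. by move=> EP FP; apply: fpsP => k; apply: (logder_eq EP FP). Qed.

(** Each coefficient of the solution E of t E' = E P depends on all previous
    ones, hence the recursion on the list of the first n + 1. *)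
Fixpoint exp_prefix P n : seq K :=
  if n is n'.+1 then
    let s := exp_prefix P n' in
    rcons s (n%:R^-1 * \sum_(i < n) s`_i * P (n - i)%N)
  else [:: 1].

Definition exp_series P : fps K := fun k => (exp_prefix P k)`_k.

Lemma size_exp_prefix P n : size (exp_prefix P n) = n.+1.
Proof. by elim: n => //= n IHn; rewrite size_rcons IHn. Qed.

Lemma nth_exp_prefix P n k : (k <= n)%N -> (exp_prefix P n)`_k = exp_series P k.
Proof.
elim: n => [|n IHn]; first by rewrite leqn0 => /eqP ->.
rewrite leq_eqVlt => /orP[/eqP -> //|lt_kn].
by rewrite /= nth_rcons size_exp_prefix lt_kn IHn.
Qed.

Lemma exp_seriesP P : P 0%N = 0 -> logder (exp_series P) P.
Proof.
move=> P0; split=> //; apply: fpsP => k.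
rewrite fps_coefM big_ord_recr /= subnn P0 mulr0 addr0 /theta.
case: k => [|k]; first by rewrite mulr0n big_ord0.
rewrite {1}/exp_series /= nth_rcons size_exp_prefix ltnn eqxx.
rewrite -[LHS]mulr_natl mulVKf ?pnatr_eq0 //; apply: eq_bigr => i _.
by rewrite nth_exp_prefix // -ltnS.
Qed.

(** The series of elementary symmetric functions of a possibly virtual family
    of numbers with the given power sums. *)
Definition esym_series p : fps K := exp_series (newton_series p).

Lemma esym_seriesP p : logder (esym_series p) (newton_series p).
Proof. exact: exp_seriesP. Qed.

Lemma esym_series0 p : esym_series p 0%N = 1. Proof. by []. Qed.

Lemma esym_series_uniq p E : logder E (newton_series p) -> E = esym_series p.
Proof. by move=> Ep; apply: logder_uniq Ep (esym_seriesP p). Qed.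

Lemma eq_esym_series p q d : (forall k, (0 < k <= d)%N -> p k = q k) ->
  forall k, (k <= d)%N -> esym_series p k = esym_series q k.
Proof.
move=> eq_pq; apply: logder_eq (esym_seriesP p) (esym_seriesP q) _.
by move=> [|k] // lt_kd; rewrite /newton_series eq_pq.
Qed.

Lemma esym_series_inj p q d :
  (forall k, (k <= d)%N -> esym_series p k = esym_series q k) ->
  forall k, (0 < k <= d)%N -> p k = q k.
Proof.
move=> eq_pq k /andP[k_gt0 le_kd].
have := logder_eq_der (esym_seriesP p) (esym_seriesP q) eq_pq le_kd.
by case: k {le_kd} k_gt0 => // k _; apply: mulfI; rewrite signr_eq0.
Qed.

Lemma esym_seriesD p q :
  esym_series (fun k => p k + q k) = esym_series p * esym_series q.
Proof.
apply/esym/esym_series_uniq.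
have -> : newton_series (fun k => p k + q k) =
    newton_series p + newton_series q.
  by apply: fpsP => -[|k]; rewrite fps_coefD /= ?addr0 // mulrDr.
exact: logderM (esym_seriesP p) (esym_seriesP q).
Qed.

Lemma prod_line_esym (I : finType) (C : pred I) (a : I -> K) :
  \prod_(i | C i) (1 + fps_const (a i) * fps_X) =
  esym_series (fun k => \sum_(i | C i) a i ^+ k).
Proof.
apply: esym_series_uniq; rewrite -newton_series_sum.
by apply: logder_prod => i; apply: logder_line.
Qed.

End PowerSums.

(** Expand the product over the subsets of the index set. *)
Lemma coef_prod_line (A : comNzRingType) n (a : 'I_n -> A) k :
  (\prod_(i < n) (1 + fps_const (a i) * fps_X)) k = (mesym n A k).@[a].
Proof.
under eq_bigr => i _ do rewrite addrC.
rewrite bigA_distr fps_coef_sum /mesym rmorph_sum [RHS]big_mkcond.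
apply: eq_bigr => J _; rewrite -big_mkcond.
transitivity ((fps_const (\prod_(i in J) a i) * fps_X ^+ #|J|) k).
  by rewrite big_split prodr_const -(big_morph _ (@fps_constM A)
    (fps_const1 A)).
rewrite fps_coefCM fps_coefXn eq_sym; case: ifP => _; rewrite ?mulr0 //.
rewrite mulr1 rmorph_prod.
by apply: eq_bigr => i _; rewrite /= mevalXU.
Qed.

(** Over an algebraically closed field, any power sums are those of d numbers
    up to degree d, namely of the roots of the reversed polynomial t^d E(-1/t),
    where E is the truncated series of elementary symmetric functions. *)
Lemma power_sums_split (p : nat -> algC) d :
  exists a : 'I_d -> algC, forall k, (0 < k <= d)%N -> p k = \sum_i a i ^+ k.
Proof.
pose e := esym_series p.
pose f : {poly algC} := \poly_(i < d.+1) ((-1) ^+ (d - i) * e (d - i)%N).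
have fE i : (i <= d)%N -> f`_i = (-1) ^+ (d - i) * e (d - i)%N.
  by move=> le_id; rewrite coef_poly ltnS le_id.
have fd : f`_d = 1 by rewrite fE // subnn mul1r.
have size_f : size f = d.+1.
  by rewrite size_poly_eq // subnn mul1r oner_eq0.
have [r fr] := closed_field_poly_normal f.
move: fr; rewrite lead_coefE size_f fd scale1r => fr.
have size_r : size r == d.
  by have := size_f; rewrite fr size_prod_XsubC => -[->].
exists (tnth (Tuple size_r)); apply: esym_series_inj => k le_kd.
rewrite -prod_line_esym coef_prod_line.
have := mroots_coeff (Tuple size_r) (Ordinal (le_kd : k < d.+1)%N).
rewrite /= -fr fE ?leq_subr // subKn // => vieta.
by apply: mulfI vieta; rewrite signr_eq0.
Qed.

(** * Values of the universal polynomials *)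

Lemma eq_evalZ (A : comPzRingType) N (P : {mpoly int[N]}) (v w : 'I_N -> A) :
  v =1 w -> evalZ P v = evalZ P w.
Proof.
move=> eq_vw; apply: eq_bigr => m _; congr (_ * _).
by apply: eq_bigr => i _; rewrite eq_vw.
Qed.

Lemma evalZ_rmorph (A B : comPzRingType) (u : {rmorphism A -> B}) N
    (P : {mpoly int[N]}) (v : 'I_N -> A) :
  u (evalZ P v) = evalZ P (fun i => u (v i)).
Proof.
rewrite rmorph_sum; apply: eq_bigr => m _.
rewrite rmorphM rmorph_int rmorph_prod; congr (_ * _).
by apply: eq_bigr => i _; rewrite rmorphXn.
Qed.

Lemma eq_join_fun (A : Type) d (u u' v v' : 'I_d -> A) :
  u =1 u' -> v =1 v' -> join_fun u v =1 join_fun u' v'.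
Proof. by move=> eu ev k; rewrite /join_fun; case: (split k). Qed.

Lemma join_fun_lshift (A : Type) d (u v : 'I_d -> A) i :
  join_fun u v (lshift d i) = u i.
Proof. by rewrite /join_fun (unsplitK (inl i)). Qed.

Lemma join_fun_rshift (A : Type) d (u v : 'I_d -> A) i :
  join_fun u v (rshift d i) = v i.
Proof. by rewrite /join_fun (unsplitK (inr i)). Qed.

Lemma join_fun_comp (A B : Type) (f : A -> B) d (u v : 'I_d -> A) k :
  f (join_fun u v k) = join_fun (fun i => f (u i)) (fun i => f (v i)) k.
Proof. by rewrite /join_fun; case: (split k). Qed.

Lemma meval_mesym (A : comNzRingType) n k (v : 'I_n -> A) :
  (mesym n A k).@[v] = \sum_(J : {set 'I_n} | #|J| == k) \prod_(i in J) v i.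
Proof.
rewrite rmorph_sum; apply: eq_bigr => J _; rewrite rmorph_prod.
by apply: eq_bigr => i _; rewrite /= mevalXU.
Qed.

Lemma coef_poly_prod_line (A : comNzRingType) (I : finType) (C : pred I)
    (a : I -> A) k :
  (\prod_(i | C i) (1 + a i *: 'X))`_k =
  (\prod_(i | C i) (1 + fps_const (a i) * fps_X)) k.
Proof.
elim/big_rec2: _ k => [|i f p _ IH] k; first by rewrite coef1 fps_coef1.
rewrite coefM fps_coefM; apply: eq_bigr => j _; rewrite IH; congr (_ * _).
by rewrite coefD coefZ coef1 coefX fps_coefD fps_coef1 fps_coefCM /fps_X;
  case: (_ == 1%N).
Qed.

(** The universal polynomial for products multiplies power sums, also those of
    virtual families. *)
Lemma product_poly_esym d (P : {mpoly int[d + d]}) (p q : nat -> algC) :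
  product_poly P ->
  evalZ P (join_fun (fun i : 'I_d => esym_series p i.+1)
                    (fun j : 'I_d => esym_series q j.+1)) =
  esym_series (fun k => p k * q k) d.
Proof.
have [a pE] := power_sums_split p d; have [b qE] := power_sums_split q d.
have esymE s (c : 'I_d -> algC) (i : 'I_d) :
    (forall k, (0 < k <= d)%N -> s k = \sum_i c i ^+ k) ->
    esym_series s i.+1 =
      \sum_(J : {set 'I_d} | #|J| == i.+1) \prod_(j in J) c j.
  move=> sE; rewrite (eq_esym_series sE) //.
  by rewrite -prod_line_esym coef_prod_line meval_mesym.
pose h : {rmorphism {mpoly int[d + d]} -> algC} := mmap intr (join_fun a b).
have hx i : h 'X_(lshift d i) = a i.
  by rewrite /h /= mmapX mmap1U join_fun_lshift.
have hy i : h 'X_(rshift d i) = b i.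
  by rewrite /h /= mmapX mmap1U join_fun_rshift.
rewrite /product_poly => /(congr1 h); rewrite evalZ_rmorph.
rewrite (eq_evalZ P (w := join_fun (fun i : 'I_d => esym_series p i.+1)
                                   (fun j : 'I_d => esym_series q j.+1)));
  last first.
  move=> i; rewrite (join_fun_comp h); apply: eq_join_fun => {}i.
    rewrite meval_mesym rmorph_sum (esymE _ _ _ pE); apply: eq_bigr => J _.
    by rewrite rmorph_prod; apply: eq_bigr => j _; rewrite /= hx.
  rewrite meval_mesym rmorph_sum (esymE _ _ _ qE); apply: eq_bigr => J _.
  by rewrite rmorph_prod; apply: eq_bigr => j _; rewrite /= hy.
move->; rewrite -coef_map pair_bigA rmorph_prod /=.
under eq_bigr => ij _ do
  rewrite rmorphD rmorph1 /= map_polyZ map_polyX rmorphM /= hx hy.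
rewrite coef_poly_prod_line prod_line_esym;
  apply: eq_esym_series (leqnn d) => k kd.
rewrite pE // qE // big_distrlr pair_bigA; apply: eq_bigr => ij _.
by rewrite exprMn.
Qed.

(** The universal polynomial for compositions also follows power sums, of the
    products over all n-element subsets; their k-th power sum is the n-th
    elementary symmetric function of the k-th powers. *)
Lemma composition_poly_esym m n (P : {mpoly int[m * n]}) (p : nat -> algC) :
  composition_poly P ->
  evalZ P (fun i : 'I_(m * n) => esym_series p i.+1) =
  esym_series (fun k => esym_series (fun j => p (j * k)%N) n) m.
Proof.
have [a pE] := power_sums_split p (m * n).
pose h : {rmorphism {mpoly int[m * n]} -> algC} := mmap intr a.
have hx i : h 'X_i = a i by rewrite /h /= mmapX mmap1U.
rewrite /composition_poly => /(congr1 h); rewrite evalZ_rmorph.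
rewrite (eq_evalZ P (w := fun i : 'I_(m * n) => esym_series p i.+1));
  last first.
  move=> i; rewrite (eq_esym_series pE) // -prod_line_esym coef_prod_line.
  rewrite meval_mesym /mesym rmorph_sum; apply: eq_bigr => J _.
  by rewrite rmorph_prod; apply: eq_bigr => j _; rewrite hx.
move->; rewrite -coef_map rmorph_prod /=.
under eq_bigr => J _.
  rewrite rmorphD rmorph1 /= map_polyZ map_polyX rmorph_prod /=.
  under eq_bigr => i _ do rewrite hx.
  over.
rewrite coef_poly_prod_line prod_line_esym;
  apply: eq_esym_series (leqnn m) => k.
move=> /andP[k_gt0 le_km].
transitivity (mesym (m * n) algC n).@[fun i => a i ^+ k].
  by rewrite meval_mesym; apply: eq_bigr => J _; rewrite prodrXl.
rewrite -coef_prod_line prod_line_esym; apply: eq_esym_series (leqnn n) => j.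
move=> /andP[j_gt0 le_jn]; rewrite pE ?muln_gt0 ?j_gt0 ?k_gt0 /=.
  by apply: eq_bigr => i _; rewrite -exprM mulnC.
by rewrite mulnC leq_mul.
Qed.

(** * Existence of the universal polynomials *)

Lemma rmorph_mpoly_eq (A B : comNzRingType) n
    (f g : {rmorphism {mpoly A[n]} -> B}) :
  (forall c, f c%:MP = g c%:MP) -> (forall i, f 'X_i = g 'X_i) -> f =1 g.
Proof.
move=> eqC eqX p; rewrite [p]mpolyE !rmorph_sum; apply: eq_bigr => m _.
rewrite -mul_mpolyC !rmorphM eqC [in 'X_[m]]mpolyXE_id !rmorph_prod.
by congr (_ * _); apply: eq_bigr => i _; rewrite !rmorphXn eqX.
Qed.

Lemma mpolyC_int n (c : int) : c%:MP = c%:~R :> {mpoly int[n]}.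
Proof. by rewrite -[in LHS](intz c) rmorph_int. Qed.

Lemma rmorph_mpoly_int_eq (B : comNzRingType) n
    (f g : {rmorphism {mpoly int[n]} -> B}) :
  (forall i, f 'X_i = g 'X_i) -> f =1 g.
Proof.
by move=> eqX; apply: rmorph_mpoly_eq => // c; rewrite mpolyC_int !rmorph_int.
Qed.

Lemma rmorph_mpoly_comp_eq (A B C D : comNzRingType) n
    (f : {rmorphism {mpoly A[n]} -> B}) (f' : {rmorphism B -> D})
    (g : {rmorphism {mpoly A[n]} -> C}) (g' : {rmorphism C -> D}) :
  (forall c, f' (f c%:MP) = g' (g c%:MP)) ->
  (forall i, f' (f 'X_i) = g' (g 'X_i)) -> forall p, f' (f p) = g' (g p).
Proof. exact: (rmorph_mpoly_eq (f := f' \o f) (g := g' \o g)). Qed.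

Lemma msymXU (A : comNzRingType) n (s : 'S_n) i :
  msym s ('X_i : {mpoly A[n]}) = 'X_(s i).
Proof. by rewrite /msym mmapX mmap1U. Qed.

(** Permuting the variables permutes the n-element subsets of their indices. *)
Lemma composition_poly_exists m n :
  exists P : {mpoly int[m * n]}, composition_poly P.
Proof.
pose F : {mpoly int[m * n]} := (\prod_(S : {set 'I_(m * n)} | #|S| == n)
   (1 + (\prod_(i in S) 'X_i) *: 'X))`_m.
have F_sym : F \is symmetric.
  apply/issymP => s; rewrite /F -coef_map rmorph_prod /=;
    congr ((polyseq _)`_ _).
  rewrite (reindex_inj (imset_inj (@perm_inj _ s^-1%g))) /=.
  under eq_bigl => S do rewrite (card_imset _ (@perm_inj _ _)).
  apply: eq_bigr => S _.
  rewrite rmorphD rmorph1 /= map_polyZ map_polyX; congr (1 + _ *: _).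
  rewrite rmorph_prod big_imset /=; last by move=> i j _ _; apply: perm_inj.
  by apply: eq_bigr => i _; rewrite msymXU permKV.
have [P [FP _]] := sym_fundamental F_sym; exists P.
rewrite /composition_poly -/F -FP /comp_mpoly /=.
by apply: eq_bigr => k _; rewrite mpolyC_int; congr (_ * _);
  apply: eq_bigr => i _; rewrite tnth_mktuple.
Qed.

(** The product of the 1 + x_i y_j t over j has coefficients e_k(y) x_i^k, so
    with indeterminates in place of the e_k(y) the product over i is symmetric
    in the x_i alone, and the fundamental theorem applies over the ring of
    polynomials in these indeterminates. *)
Lemma product_poly_exists d : exists P : {mpoly int[d + d]}, product_poly P.
Proof.
pose M := {mpoly int[d + d]}; pose A := {mpoly int[d]}.
pose F : {mpoly A[d]} := (\prod_(i < d)
   (1 + \sum_(j < d) (('X_j : A)%:MP * 'X_i ^+ j.+1) *: 'X^(j.+1)))`_d.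
have F_sym : F \is symmetric.
  apply/issymP => s; rewrite /F -coef_map rmorph_prod /=;
    congr ((polyseq _)`_ _).
  rewrite [RHS](reindex_inj (@perm_inj _ s)); apply: eq_bigr => i _.
  rewrite rmorphD rmorph1 rmorph_sum /=; congr (1 + _); apply: eq_bigr => j _.
  by rewrite map_polyZ map_polyXn rmorphM rmorphXn /= msymXU /msym mmapC.
have [Q [FQ _]] := sym_fundamental F_sym.
pose x (i : 'I_d) : M := 'X_(lshift d i).
pose y (j : 'I_d) : M := 'X_(rshift d j).
pose ex (i : 'I_d) : M := (mesym d M i.+1).@[x].
pose ey (j : 'I_d) : M := (mesym d M j.+1).@[y].
pose to_y : {rmorphism A -> M} := mmap intr y.
pose to_ey : {rmorphism A -> M} := mmap intr ey.
pose to_xy : {rmorphism {mpoly A[d]} -> M} := mmap to_y x.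
pose to_x_ey : {rmorphism {mpoly A[d]} -> M} := mmap to_ey x.
pose ev : {rmorphism M -> M} := mmap intr (join_fun ex ey).
pose comp_e : {rmorphism {mpoly A[d]} -> {mpoly A[d]}} :=
  comp_mpoly [tuple mesym d A i.+1 | i < d].
have to_yX j : to_y 'X_j = y j by rewrite /= mmapX mmap1U.
have to_eyX j : to_ey 'X_j = ey j by rewrite /= mmapX mmap1U.
have to_xyC c : to_xy c%:MP = to_y c by apply: mmapC.
have to_xyX i : to_xy 'X_i = x i by rewrite /= mmapX mmap1U.
have to_x_eyC c : to_x_ey c%:MP = to_ey c by apply: mmapC.
have to_x_eyX i : to_x_ey 'X_i = x i by rewrite /= mmapX mmap1U.
have evX k : ev 'X_k = join_fun ex ey k by rewrite /= mmapX mmap1U.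
have comp_eC c : comp_e c%:MP = c%:MP by apply: comp_mpolyC.
have comp_eX i : comp_e 'X_i = mesym d A i.+1.
  by rewrite /= comp_mpolyXU -tnth_nth tnth_mktuple.
exists (to_xy Q); rewrite /product_poly -/M -/x -/y.
transitivity (ev (to_xy Q)); first by [].
have {}FQ : comp_e Q = F by [].
(* From here on the evaluation morphisms matter only through their values on
   constants and variables. *)
move: to_y to_ey to_xy to_x_ey ev comp_e to_yX to_eyX to_xyC to_xyX to_x_eyC
  to_x_eyX evX comp_eC comp_eX FQ.
move=> to_y to_ey to_xy to_x_ey ev comp_e to_yX to_eyX to_xyC to_xyX to_x_eyC
  to_x_eyX evX comp_eC comp_eX FQ.
have ev_xy p : ev (to_xy p) = to_x_ey (comp_e p).
  apply: rmorph_mpoly_comp_eq p => [c|i].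
    rewrite to_xyC comp_eC to_x_eyC.
    apply: (rmorph_mpoly_int_eq (f := ev \o to_y)) => j.
    by rewrite to_eyX -[LHS]/(ev (to_y _)) to_yX evX join_fun_rshift.
  rewrite to_xyX comp_eX evX join_fun_lshift /ex meval_mesym rmorph_sum.
  apply: eq_bigr => J _; rewrite rmorph_prod.
  by apply: eq_bigr => j _; rewrite to_x_eyX.
rewrite ev_xy FQ /F -coef_map rmorph_prod /=.
congr ((polyseq _)`_ _); apply: eq_bigr => i _.
rewrite rmorphD rmorph1 rmorph_sum /=.
transitivity (\sum_(k < d.+1) ((mesym d M k).@[y] * x i ^+ k) *: 'X^k).
  rewrite big_ord_recl mesym0E meval1 mul1r scale1r; congr (_ + _).
  apply: eq_bigr => j _; rewrite map_polyZ map_polyXn (rmorphM to_x_ey).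
  by rewrite (rmorphXn to_x_ey) to_x_eyC to_x_eyX to_eyX.
apply/polyP => k; rewrite coef_poly_prod_line coef_prod_line.
have -> : (mesym d M k).@[fun j => x i * y j] = (mesym d M k).@[y] * x i ^+ k.
  rewrite !meval_mesym mulr_suml; apply: eq_bigr => J /eqP <-.
  by rewrite big_split prodr_const mulrC.
rewrite coef_sum; have [lt_kd|le_dk] := ltnP k d.+1.
  rewrite (bigD1 (Ordinal lt_kd)) //= coefZ coefXn eqxx mulr1 big1 ?addr0 //.
  move=> j; rewrite -val_eqE /= eq_sym => /negbTE neq_jk.
  by rewrite coefZ coefXn neq_jk mulr0.
rewrite mesym_geqnE // meval0 mul0r big1 // => j _.
by rewrite coefZ coefXn gtn_eqF ?mulr0 // (leq_trans (ltn_ord j)).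
Qed.

(** * A lambda-ring with a Pfister element that is not torsion *)

Section EsymValues.
Variable K : numFieldType.
Implicit Types p q : nat -> K.

Lemma esym_series1 p : esym_series p 1%N = p 1%N.
Proof.
have := logder_rec 1 (esym_seriesP p).
by rewrite big_ord1 mulr1n esym_series0 mul1r /= mul1r.
Qed.

Lemma esym_series_line (a : K) :
  esym_series (fun k => a ^+ k) = 1 + fps_const a * fps_X.
Proof. exact/esym/esym_series_uniq/logder_line. Qed.

Lemma esym_series_ext p q : (forall k, (0 < k)%N -> p k = q k) ->
  esym_series p = esym_series q.
Proof.
by move=> eq_pq; apply: fpsP => k;
  apply: (@eq_esym_series _ p q k) => // j /andP[/eq_pq].
Qed.

End EsymValues.

(** The Adams operations psi^k of this ring are the identity for odd k and
    (a, b) |-> (a, a) for even k, as in the representation ring of a group of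
    order two, with a the value at the identity and b at the other element. *)
Definition adams2 (x : algC * algC) (k : nat) : algC :=
  if odd k then x.2 else x.1.

Definition lambda2 (d : nat) (x : algC * algC) : algC * algC :=
  (esym_series (fun=> x.1) d, esym_series (adams2 x) d).

Lemma lambda2_ring : lambda_ring lambda2.
Proof.
have eq2 (u v : algC * algC) : u.1 = v.1 -> u.2 = v.2 -> u = v.
  by case: u v => [? ?] [? ?] /= -> ->.
have fst_evalZ N P (v : 'I_N -> algC * algC) :
    (evalZ P v).1 = evalZ P (fun i => (v i).1).
  exact: (evalZ_rmorph fst).
have snd_evalZ N P (v : 'I_N -> algC * algC) :
    (evalZ P v).2 = evalZ P (fun i => (v i).2).
  exact: (evalZ_rmorph snd).
split.
- by move=> x; apply: eq2.
- by move=> x; apply: eq2; rewrite /= esym_series1.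
- move=> d x y; apply: eq2.
    rewrite (raddf_sum fst) /= -fps_coefM -esym_seriesD.
    by congr (_ d); apply: esym_series_ext.
  rewrite (raddf_sum snd) /= -fps_coefM -esym_seriesD.
  congr (_ d); apply: esym_series_ext => k _; rewrite /adams2.
  by case: ifP.
- move=> d d_gt1; have one2 (p : nat -> algC) : (forall k, p k = 1) ->
      esym_series p d = 0.
    move=> p1; have -> : esym_series p = esym_series (fun k => 1 ^+ k).
      by apply: esym_series_ext => k _; rewrite p1 expr1n.
    rewrite esym_series_line fps_coefD fps_coef1 fps_coefCM /fps_X.
    by case: d d_gt1 => [|[|d]] // _; rewrite mulr0 addr0.
  by apply: eq2; apply: one2 => // k; rewrite /adams2 if_same.
- move=> d; have [P PP] := product_poly_exists d; exists P => // x y.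
  apply: eq2; rewrite ?fst_evalZ ?snd_evalZ.
    rewrite (eq_evalZ P (join_fun_comp fst _ _)).
    rewrite (product_poly_esym (fun=> x.1) (fun=> y.1) PP).
    by apply: eq_esym_series (leqnn d).
  rewrite (eq_evalZ P (join_fun_comp snd _ _)).
  rewrite (product_poly_esym (adams2 x) (adams2 y) PP).
  by apply: eq_esym_series (leqnn d) => k _; rewrite /adams2; case: ifP.
- move=> m n; have [P PP] := composition_poly_exists m n; exists P => // x.
  apply: eq2; rewrite ?fst_evalZ ?snd_evalZ.
    rewrite (composition_poly_esym (fun=> x.1) PP).
    by apply: eq_esym_series (leqnn m).
  rewrite (composition_poly_esym (adams2 x) PP).
  apply: eq_esym_series (leqnn m) => k _; rewrite {1}/adams2.
  case: ifP => odd_k; apply: eq_esym_series (leqnn n) => j _.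
    by rewrite /adams2 oddM odd_k andbT.
  by rewrite /adams2 oddM odd_k andbF.
Qed.

(** * Lambda operations on products of Pfister elements *)

Definition quad_series m : fps int :=
  (fps_X + (2 ^+ m)%R%:S * fps_X ^+ 2)%fps.

Lemma quad_seriesE m : quad_series m = fps_X + fps_const (2 ^+ m) * fps_X ^+ 2.
Proof. by rewrite /quad_series fps_expE. Qed.

Lemma quad_series_coef0 m : quad_series m 0%N = 0.
Proof.
by rewrite quad_seriesE fps_coefD fps_coefCM expr2 fps_coefXM mulr0 addr0.
Qed.

Lemma comp_quad_series m (g : fps int) : g 0%N = 0 ->
  fps_comp (quad_series m) g = g + fps_const (2 ^+ m) * g ^+ 2.
Proof.
move=> g0; rewrite quad_seriesE fps_compD fps_compM // fps_compC fps_compXn //.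
by rewrite !fps_compXl.
Qed.

(** The coefficients of lambda_t(x) = 1 + x g(t) for an (m+1)-Pfister element
    x.  Where x takes its nonzero value 2^(m+1), lambda_t(x) is
    ((1 + t)/(1 - t))^(2^m), and squaring gives the recursion. *)
Fixpoint pfister_series m : fps int :=
  if m is m'.+1 then fps_comp (quad_series m') (pfister_series m')
  else fun k => (0 < k)%N%:R.

Lemma pfister_series_coef0 m : pfister_series m 0%N = 0.
Proof. by case: m => //= m; rewrite fps_comp_coef0 quad_series_coef0. Qed.

Lemma pfister_series_coef1 m : pfister_series m 1%N = 1.
Proof.
elim: m => //= m IHm; rewrite fps_comp_coef1 IHm mulr1 quad_seriesE.
by rewrite fps_coefD fps_coefCM expr2 fps_coefXM mulr0 addr0.
Qed.

Definition odd_sums (A : nmodType) (x : A) (k : nat) : A :=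
  if odd k then x else 0.

(** This is the value of lambda_t at a point where an (m+1)-Pfister element
    takes the value 2^(m+1): the power sums of the element are its images under
    the Adams operations, which fix it in odd degrees and kill it in even
    ones. *)
Lemma esym_odd_sums m :
  esym_series (odd_sums (2 ^+ m.+1 : algC)) =
  1 + fps_const (2 ^+ m.+1) * fps_map intr (pfister_series m).
Proof.
elim: m => [|m IHm].
  (* both sides become 1 + t after multiplication by 1 - t *)
  apply/eqP; rewrite -subr_eq0; apply/eqP.
  apply: (@fps_mulfI _ (esym_series (fun k => (-1) ^+ k) : fps algC)).
    by rewrite esym_series0 oner_eq0.
  rewrite mulrBr -esym_seriesD; apply/eqP; rewrite subr_eq0; apply/eqP.
  transitivity (esym_series (fun k => (1 : algC) ^+ k)).
    apply: esym_series_ext => k _; rewrite /odd_sums expr1 expr1n -signr_odd.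
    by case: (odd k); rewrite ?expr1 ?expr0 ?addr0 //; ring.
  rewrite !esym_series_line; apply: fpsP => k.
  rewrite mulrDl mul1r -mulrA !(fps_coefD, fps_coefCM) fps_coefXM.
  by case: k => [|[|k]]; rewrite ?(fps_coefD, fps_coefCM) !fps_coef1 /fps_map
    /fps_X /=; ring.
have -> : esym_series (odd_sums (2 ^+ m.+2 : algC)) =
    esym_series (odd_sums (2 ^+ m.+1)) ^+ 2.
  rewrite expr2 -esym_seriesD; apply: esym_series_ext => k _.
  by rewrite /odd_sums; case: ifP => _; rewrite ?addr0 // exprS; ring.
rewrite IHm /= comp_quad_series ?pfister_series_coef0 // fps_mapD fps_mapM.
rewrite fps_mapC fps_mapXn rmorphXn.
rewrite [2 ^+ m.+2]exprS [2 ^+ m.+1]exprS !fps_constM (fps_constMn _ 2); ring.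
Qed.

(** If X^2 = N X and Y^2 = M Y, polynomial expressions in X and Y lie in the
    span of 1, X, Y, XY, with coefficients that do not depend on the ring: they
    can be computed in one ring and used in another. *)
Definition spans (N M : int)
    (F : forall R : comPzRingType, R -> R -> R) : Prop :=
  exists a b c d : int, forall (R : comPzRingType) (X Y : R),
    X ^+ 2 = N%:~R * X -> Y ^+ 2 = M%:~R * Y ->
    F R X Y = a%:~R + b%:~R * X + c%:~R * Y + d%:~R * (X * Y).

Section Spans.
Variables N M : int.

Lemma spans_int (k : int) : spans N M (fun R _ _ => k%:~R).
Proof. by exists k, 0, 0, 0 => R X Y _ _; rewrite !mul0r !addr0. Qed.

Lemma spansD F G : spans N M F -> spans N M G ->
  spans N M (fun R X Y => F R X Y + G R X Y).
Proof.
move=> [a [b [c [d FE]]]] [a' [b' [c' [d' GE]]]].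
exists (a + a'), (b + b'), (c + c'), (d + d') => R X Y XX YY.
by rewrite FE // GE // !rmorphD /=; ring.
Qed.

Lemma spansM F G : spans N M F -> spans N M G ->
  spans N M (fun R X Y => F R X Y * G R X Y).
Proof.
move=> [a [b [c [d FE]]]] [a' [b' [c' [d' GE]]]].
exists (a * a'), (a * b' + b * a' + N * b * b'),
  (a * c' + c * a' + M * c * c'),
  (a * d' + d * a' + b * c' + c * b' + N * (b * d' + d * b')
   + M * (c * d' + d * c') + N * M * d * d') => R X Y XX YY.
rewrite FE // GE //.
have {}XX : X * X - N%:~R * X = 0 by rewrite -expr2 XX subrr.
have {}YY : Y * Y - M%:~R * Y = 0 by rewrite -expr2 YY subrr.
apply/eqP; rewrite -subr_eq0; apply/eqP.
(* the difference, written in the ideal of the two relations *)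
transitivity ((X * X - N%:~R * X) *
    (b%:~R * b'%:~R + (b%:~R * d'%:~R + d%:~R * b'%:~R) * Y
     + d%:~R * d'%:~R * (Y * Y)) +
  (Y * Y - M%:~R * Y) *
    (c%:~R * c'%:~R + (c%:~R * d'%:~R + d%:~R * c'%:~R) * X
     + N%:~R * d%:~R * d'%:~R * X)).
  by rewrite !(rmorphD, rmorphM) /=; ring.
by rewrite XX YY !mul0r addr0.
Qed.

Lemma spansXn F k : spans N M F -> spans N M (fun R X Y => F R X Y ^+ k).
Proof.
move=> spF; elim: k => [|k IHk]; first exact: spans_int 1.
have [a [b [c [d FE]]]] := spansM spF IHk; exists a, b, c, d => R X Y XX YY.
by rewrite exprS FE.
Qed.

Lemma spans_sum (I : Type) (r : seq I) F : (forall i, spans N M (F i)) ->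
  spans N M (fun R X Y => \sum_(i <- r) F i R X Y).
Proof.
move=> spF; elim: r => [|i r IHr].
  have [a [b [c [d FE]]]] := spans_int 0; exists a, b, c, d => R X Y XX YY.
  by rewrite big_nil -FE.
have [a [b [c [d FE]]]] := spansD (spF i) IHr; exists a, b, c, d => R X Y XX YY.
by rewrite big_cons FE.
Qed.

Lemma spans_prod (I : Type) (r : seq I) F : (forall i, spans N M (F i)) ->
  spans N M (fun R X Y => \prod_(i <- r) F i R X Y).
Proof.
move=> spF; elim: r => [|i r IHr].
  have [a [b [c [d FE]]]] := spans_int 1; exists a, b, c, d => R X Y XX YY.
  by rewrite big_nil -FE.
have [a [b [c [d FE]]]] := spansM (spF i) IHr; exists a, b, c, d => R X Y XX YY.
by rewrite big_cons FE.
Qed.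

Lemma spans_evalZ n (P : {mpoly int[n]}) v : (forall i, spans N M (v i)) ->
  spans N M (fun R X Y => evalZ P (fun i => v i R X Y)).
Proof.
move=> spv; apply: spans_sum => m; apply: spansM; first exact: spans_int.
by apply: spans_prod => i; apply: spansXn.
Qed.

End Spans.

Lemma esym_odd_sums0 : esym_series (odd_sums (0 : algC)) = 1.
Proof.
apply/esym/esym_series_uniq; have -> : newton_series (odd_sums (0 : algC)) = 0.
  by apply: fpsP => -[|k]; rewrite fps_coef0 //= /odd_sums if_same mulr0.
exact: logder1.
Qed.

(** The coefficients of the value on 1, x, y, xy are determined by the complex
    points x = 0 or 2, y = 0 or 2^(m+1).  There the value is known from power
    sums: those of x, y and xy vanish in even degrees and are constant in odd
    degrees. *)
Lemma product_poly_pfister m d (P : {mpoly int[d + d]}) : (0 < d)%N ->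
  product_poly P -> forall (R : comPzRingType) (x y : R),
  x ^+ 2 = 2%:~R * x -> y ^+ 2 = (2 ^+ m.+1)%:~R * y ->
  evalZ P (join_fun (fun i : 'I_d => x)
                    (fun j : 'I_d => (pfister_series m j.+1)%:~R * y)) =
  (pfister_series m.+1 d)%:~R * (x * y).
Proof.
move=> d_gt0 PP; set g := pfister_series m; set N : int := 2 ^+ m.+1.
pose v (k : 'I_(d + d)) (R : comPzRingType) (X Y : R) :=
  join_fun (fun i : 'I_d => X) (fun j : 'I_d => (g j.+1)%:~R * Y) k.
have spX : spans 2 N (fun R X Y => X).
  by exists 0, 1, 0, 0 => R X Y _ _; rewrite !mul0r mul1r add0r !addr0.
have spY : spans 2 N (fun R X Y => Y).
  by exists 0, 0, 1, 0 => R X Y _ _; rewrite !mul0r mul1r !add0r addr0.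
have spv k : spans 2 N (v k).
  rewrite /v /join_fun; case: (split k) => j //.
  exact: spansM (spans_int _ _ _) spY.
have [a [b [c [e PE]]]] := spans_evalZ P spv.
have esymX (X : algC) : X = 0 \/ X = 2 ->
    forall i, esym_series (odd_sums X) i.+1 = X.
  case=> -> i; first by rewrite esym_odd_sums0 fps_coef1.
  have := esym_odd_sums 0; rewrite expr1 => ->.
  by rewrite fps_coefD fps_coefCM fps_coef1 add0r /fps_map /= mulr1.
have esymY (Y : algC) : Y = 0 \/ Y = 2 ^+ m.+1 ->
    forall i, esym_series (odd_sums Y) i.+1 = (g i.+1)%:~R * Y.
  case=> -> i; first by rewrite esym_odd_sums0 fps_coef1 mulr0.
  by rewrite esym_odd_sums fps_coefD fps_coefCM fps_coef1 add0r mulrC.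
have val (X Y : algC) : X = 0 \/ X = 2 -> Y = 0 \/ Y = 2 ^+ m.+1 ->
    esym_series (odd_sums (X * Y)) d =
    a%:~R + b%:~R * X + c%:~R * Y + e%:~R * (X * Y).
  move=> hX hY; rewrite -PE.
  - rewrite /v (eq_evalZ P (eq_join_fun (fun i => esym (esymX X hX i))
                                       (fun j => esym (esymY Y hY j)))).
    rewrite product_poly_esym //; apply: eq_esym_series (leqnn d) => k _.
    by rewrite /odd_sums; case: ifP; rewrite ?mulr0.
  - by case: hX => ->; rewrite expr2 ?mulr0.
  - by case: hY => ->; rewrite expr2 ?mulr0 // /N rmorphXn.
have one_d : (1 : fps algC) d = 0 by rewrite fps_coef1 gtn_eqF.
have := val 0 0 (or_introl erefl) (or_introl erefl).
have := val 2 0 (or_intror erefl) (or_introl erefl).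
have := val 0 _ (or_introl erefl) (or_intror erefl).
have := val 2 _ (or_intror erefl) (or_intror erefl).
rewrite !mulr0 !mul0r !mulr0 !addr0 esym_odd_sums0 one_d -exprS esym_odd_sums.
rewrite fps_coefD fps_coefCM one_d add0r => v11 v01 v10 v00.
have n0 k : (2 : algC) ^+ k != 0 by rewrite expf_eq0 pnatr_eq0 andbF.
move: v10 v01 v11; rewrite -v00 !add0r.
have {v00} a0 : a = 0 by apply/eqP; rewrite -(intr_eq0 algC) -v00.
move=> /esym/eqP; rewrite mulf_eq0 (negbTE (n0 1%N)) orbF intr_eq0 => /eqP b0.
move=> /esym/eqP; rewrite mulf_eq0 (negbTE (n0 _)) orbF intr_eq0 => /eqP c0.
rewrite b0 c0 !mul0r !add0r mulrC => /(mulIf (n0 _)) /intr_inj gE.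
by move=> R x y xx yy; rewrite [LHS]PE // a0 b0 c0 !mul0r !add0r -gE.
Qed.

(** Split off one Pfister factor and apply the universal polynomial for the
    product. *)
Lemma lambda_pfister_prod (R : comPzRingType) (lam : nat -> R -> R) m (x : R) :
  lambda_ring lam -> n_pfister lam m.+1 x ->
  x ^+ 2 = (2 ^+ m.+1)%:~R * x /\
  forall d, (0 < d)%N -> lam d x = (pfister_series m d)%:~R * x.
Proof.
move=> lamR [a pf_a ->{x}]; elim: m a pf_a => [|m IHm] a pf_a.
  rewrite big_ord1; have [aa lam_a] := pf_a ord0.
  rewrite aa expr1 -[LHS]mulr_natl; split=> // d d_gt0.
  by rewrite lam_a //= d_gt0 mul1r.
have [aa lam_a] := pf_a ord0; set x := a ord0 in aa lam_a.
rewrite big_ord_recl -/x; set y := \prod_(i < m.+1) _.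
have [yy lam_y] : y ^+ 2 = (2 ^+ m.+1)%:~R * y /\
    forall d, (0 < d)%N -> lam d y = (pfister_series m d)%:~R * y.
  by apply: (IHm (fun i => a (lift ord0 i))) => i; apply: pf_a.
have xx : x ^+ 2 = 2%:~R * x by rewrite aa -[LHS]mulr_natl.
split=> [|d d_gt0].
  by rewrite exprMn xx yy mulrACA -rmorphM -exprS.
have [P PP ->] := lamM lamR d.
rewrite -(product_poly_pfister d_gt0 PP xx yy); apply: eq_evalZ.
by apply: eq_join_fun => i; rewrite ?lam_a ?lam_y.
Qed.

(** Evaluating lambda_t(x) = 1 + x g(t) at alpha(t). *)
Lemma alpha_t_pfister (R : comPzRingType) (lam : nat -> R -> R) m (x : R)
    (alpha : fps int) k :
  lambda_ring lam -> n_pfister lam m.+1 x -> (0 < k)%N ->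
  alpha_t lam (fps_map intr alpha) x k =
  (fps_comp (pfister_series m) alpha k)%:~R * x.
Proof.
move=> lamR pf_x k_gt0; have [_ lam_x] := lambda_pfister_prod lamR pf_x.
have expE d j : fps_exp (fps_map intr alpha : fps R) d j = ((alpha ^+ d) j)%:~R.
  elim: d j => [|d IHd] j.
    by rewrite expr0 fps_coef1 /= /fps_const; case: eqP.
  rewrite exprS /= fps_coefM rmorph_sum; apply: eq_bigr => i _.
  by rewrite [in LHS]IHd rmorphM.
rewrite /alpha_t fps_comp_coef rmorph_sum mulr_suml; apply: eq_bigr => d _.
rewrite expE; case: (posnP d) => [->|d_gt0]; last first.
  by rewrite lam_x // rmorphM mulrAC.
by rewrite pfister_series_coef0 mul0r mul0r expr0 fps_coef1 gtn_eqF // mulr0.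
Qed.

(** * Square roots and the Catalan series *)

Lemma fps_binpow_coef c a k : fps_binpow c a k = binomial_series a k * c ^+ k.
Proof.
rewrite /fps_binpow fps_comp_coef (bigD1 ord_max) //= big1 ?addr0 => [|d].
  by rewrite exprMn fps_constXn fps_coefCM fps_coefXn eqxx mulr1.
rewrite -val_eqE eq_sym /= => /negbTE neq_dk.
by rewrite exprMn fps_constXn fps_coefCM fps_coefXn neq_dk !mulr0.
Qed.

Lemma fps_binpow_rec c a k :
  fps_binpow c a k.+1 *+ k.+1 = c * (a - k%:R) * fps_binpow c a k.
Proof.
rewrite !fps_binpow_coef /binomial_series big_ord_recr factS natrM exprS /=.
rewrite -mulr_natl; field.
by rewrite pnatr_eq0 -lt0n fact_gt0 nat1r pnatr_eq0.
Qed.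

Lemma logder_binpow c a :
  logder (fps_binpow c a) (fps_const a * newton_series (fun k => c ^+ k))%R.
Proof.
have E0 : fps_binpow c a 0%N = 1.
  by rewrite fps_binpow_coef /binomial_series big_ord0 fact0 divr1 mulr1.
split=> //; apply/eqP; rewrite -subr_eq0; apply/eqP.
apply: (@fps_mulfI _ (1 + fps_const c * fps_X)%R).
  by rewrite fps_coefD fps_coefCM fps_coef1 mulr0 addr0 oner_eq0.
set E := fps_binpow c a in E0 *; set P := newton_series _.
have -> : (1 + fps_const c * fps_X) * (theta E - E * (fps_const a * P)) =
    theta E + fps_const c * (fps_X * theta E) -
    fps_const a * (((1 + fps_const c * fps_X) * P) * E) by ring.
rewrite line_newton -mulrA; apply: fpsP => k.
rewrite fps_coef0 fps_coefB fps_coefD !fps_coefCM !fps_coefXM.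
case: k => [|k]; first by rewrite /theta mulr0n !mulr0 addr0 subrr.
by rewrite /theta fps_binpow_rec -/E -[E k *+ k]mulr_natl; ring.
Qed.

(** As am = 1, both sides have the logarithmic derivative ct/(1 + ct). *)
Lemma fps_binpow_root c a m : a * m%:R = 1 ->
  fps_binpow c a ^+ m = 1 + fps_const c * fps_X.
Proof.
move=> am1; have := logderXn m (logder_binpow c a).
rewrite -mulr_natl mulrA -fps_constMn -fps_constM mulrC [m%:R * a]mulrC am1.
by rewrite mulr1 => /logder_uniq; apply; apply: logder_line.
Qed.

(** Equal squares f^2 = g^2 give (f - g)(f + g) = 0, where f + g has constant
    term 2. *)
Lemma fps_root_inj (A : idomainType) (f g : fps A) m : (2 : A) != 0 ->
  f 0%N = 1 -> g 0%N = 1 -> f ^+ (2 ^ m) = g ^+ (2 ^ m) -> f = g.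
Proof.
move=> n2 f0 g0; elim: m => [|m IHm]; first by rewrite !expr1.
rewrite expnSr !exprM => eq_fg; apply: IHm; apply/eqP; rewrite -subr_eq0;
  apply/eqP.
apply: (@fps_mulfI _ (f ^+ (2 ^ m) + g ^+ (2 ^ m))%R).
  by rewrite fps_coefD !fps_coefXn0 f0 g0 !expr1n.
by rewrite mulrC -subr_sqr eq_fg subrr.
Qed.

Lemma fps_invP (K : fieldType) (f : fps K) : f 0%N != 0 -> f * fps_inv f = 1.
Proof.
move=> f0; rewrite /fps_inv; set u := (f 0%N)^-1.
set h : fps K := 1 - fps_const u * f.
have h0 : h 0%N = 0 by rewrite /h fps_coefB fps_coefCM fps_coef1 mulVf ?subrr.
pose geo : fps K := fun=> 1.
have geoE : (1 - fps_X) * geo = 1.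
  apply: fpsP => k; rewrite mulrBl mul1r fps_coefB fps_coefXM fps_coef1.
  by case: k => [|k]; rewrite ?subr0 ?subrr.
have := congr1 (fun f => fps_comp f h) geoE.
rewrite fps_compM // fps_compB fps_comp1 fps_compXl // => <-.
rewrite -/geo -/h; set gh := fps_comp geo h.
rewrite -[fps_mul _ _]/(fps_const u * gh); rewrite /h; ring.
Qed.

Lemma catalan_dvd k : (k.+1 * ('C(k.*2, k) %/ k.+1) = 'C(k.*2, k))%N.
Proof.
rewrite mulnC divnK //; apply/dvdnP.
exists ('C(k.*2, k) - 'C(k.*2, k.+1))%N; rewrite mulnBl [X in (_ - X)%N]mulnC.
rewrite mul_bin_left -addnn addnK [X in (X - _)%N]mulnC -mulnBl.
by rewrite subSnn mul1n.
Qed.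

Lemma central_bin_rec k :
  (k.+1 * 'C(k.+1.*2, k.+1) = (k.*2.+1).*2 * 'C(k.*2, k))%N.
Proof.
have := mul_bin_diag k.+1.*2 k; have := mul_bin_down k.*2.+1 k.
rewrite doubleS /= -addnn subSn ?leq_addr // addnK => e1 e2.
apply/eqP; rewrite -(eqn_pmul2l (ltn0Sn k)) -e2; apply/eqP.
rewrite mulnCA -e1 -!muln2; ring.
Qed.

(** Both sides satisfy the first-order recursion of central binomial
    coefficients. *)
Lemma catalan_sqrt :
  (2%:R * fps_X * fps_map intr catalan_series : fps rat) =
  1 - fps_binpow (- 4)%R (1 / 2)%R.
Proof.
set S := fps_binpow _ _.
have SE k : S k.+1 * k.+1%:R = - (2 * 'C(k.*2, k)%:R).
  elim: k => [|k IHk].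
    rewrite mulr1 -[LHS]mulr1n fps_binpow_rec fps_binpow_coef.
    by rewrite /binomial_series big_ord0 fact0 bin0; field.
  apply: (@mulfI _ k.+1%:R); first by rewrite pnatr_eq0.
  rewrite [LHS]mulrC mulr_natr fps_binpow_rec -/S.
  have -> : (-4) * (1 / 2 - k.+1%:R) * S k.+1 * k.+1%:R =
      (4 * k%:R + 2) * (S k.+1 * k.+1%:R) by rewrite -natr1; field.
  have central : (k.+1%:R * 'C(k.+1.*2, k.+1)%:R : rat) =
      (4 * k%:R + 2) * 'C(k.*2, k)%:R.
    by rewrite -natrM central_bin_rec -!muln2 !natrM -natr1 natrM; ring.
  rewrite IHk; transitivity (- 2 * ((4 * k%:R + 2) * 'C(k.*2, k)%:R) : rat).
    by ring.
  by rewrite -central; ring.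
apply: fpsP => k; rewrite fps_coefB -mulrA -fps_constMn fps_coefCM fps_coefXM
  fps_coef1.
case: k => [|k].
  by rewrite /S fps_binpow_coef /binomial_series big_ord0 fact0 mulr0 !divr1
    subrr.
apply: (@mulIf _ k.+1%:R); first by rewrite pnatr_eq0.
rewrite mulrBl mul0r sub0r SE opprK -mulrA; congr (_ * _).
rewrite /fps_map /catalan_series /= -pmulrn -natrM; congr (_%:R).
by rewrite mulnC catalan_dvd.
Qed.

(** Squaring the closed form of 1 - 2tC gives 4t(1 + tC^2 - C) = 0. *)
Lemma catalan_seriesE : catalan_series = 1 + fps_X * catalan_series ^+ 2.
Proof.
set C := catalan_series; set D : fps rat := fps_map intr C.
suff DE : D = 1 + fps_X * D ^+ 2.
  apply: fpsP => k; apply: (@intr_inj rat).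
  have : D = fps_map intr (1 + fps_X * C ^+ 2)%R.
    by rewrite fps_mapD fps_map1 fps_mapM fps_mapX fps_mapXn.
  by move/(congr1 (fun f => f k)).
have SS : (1 - 2%:R * fps_X * D) ^+ 2 = 1 + fps_const (-4) * fps_X.
  rewrite catalan_sqrt subKr fps_binpow_root //; by field.
have const4 : fps_const (-4) = - 4%:R :> fps rat.
  rewrite -fps_constMn; apply: fpsP => j; rewrite fps_coefN /fps_const.
  by case: eqP; rewrite ?oppr0.
have XDE : - 4%:R * (fps_X * D) =
    - 4%:R * (fps_X * (1 + fps_X * D ^+ 2)) :> fps rat.
  have -> : - 4%:R * (fps_X * D) =
     (1 - 2%:R * fps_X * D) ^+ 2 - 1 - 4%:R * fps_X * (fps_X * D ^+ 2)
       :> fps rat.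
    by ring.
  by rewrite SS const4; ring.
apply: fps_XI; apply: fpsP => k; apply: (@mulfI _ (-4)); first by [].
by have := congr1 (fun f => f k) XDE; rewrite -const4 !fps_coefCM.
Qed.

(** * The series with Pfister dimension at most one *)

Definition catalan_shift m : fps int :=
  (fps_X * fps_comp catalan_series ((- 2 ^+ m)%R%:S * fps_X))%fps.

Lemma catalan_shift_coef0 m : catalan_shift m 0%N = 0.
Proof. exact: fps_coefXM. Qed.

Lemma catalan_shift_coef1 m : catalan_shift m 1%N = 1.
Proof. by rewrite [LHS]fps_coefXM fps_comp_coef0. Qed.

(** With u = -2^m t this is the equation C(u) = 1 + u C(u)^2, times t. *)
Lemma quad_catalan m : fps_comp (quad_series m) (catalan_shift m) = fps_X.
Proof.
rewrite comp_quad_series ?catalan_shift_coef0 //.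
set u : fps int := fps_const (- 2 ^+ m) * fps_X.
have u0 : u 0%N = 0 by rewrite /u fps_coefCM mulr0.
rewrite -[catalan_shift m]/(fps_X * fps_comp catalan_series u).
have := congr1 (fun f => fps_comp f u) catalan_seriesE.
rewrite fps_compD fps_comp1 fps_compM // fps_compXl // fps_compXn //.
set C := fps_comp _ u => CE.
have -> : fps_const (2 ^+ m) * (fps_X * C) ^+ 2 = - (fps_X * (u * C ^+ 2)).
  have -> : fps_const (2 ^+ m) = - fps_const (- 2 ^+ m) :> fps int.
    by apply: fpsP => k; rewrite fps_coefN /fps_const; case: eqP;
      rewrite ?opprK ?oppr0.
  by rewrite /u; ring.
by rewrite {1}CE; ring.
Qed.

(** A right inverse of quad_series m is a left inverse, as composing with
    quad_series m on the left is injective on series without constant term. *)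
Lemma catalan_quad m : fps_comp (catalan_shift m) (quad_series m) = fps_X.
Proof.
set s := fps_comp _ _.
have s0 : s 0%N = 0 by rewrite /s fps_comp_coef0 catalan_shift_coef0.
have : fps_comp (quad_series m) s = quad_series m.
  rewrite fps_compA ?catalan_shift_coef0 ?quad_series_coef0 // quad_catalan.
  by rewrite fps_compXl ?quad_series_coef0.
rewrite comp_quad_series // quad_seriesE => sE.
apply/eqP; rewrite -subr_eq0; apply/eqP.
apply: (@fps_mulfI _ (1 + fps_const (2 ^+ m) * (s + fps_X))%R).
  by rewrite fps_coefD fps_coefCM fps_coefD fps_coef1 s0 addr0 mulr0 addr0.
transitivity (s + fps_const (2 ^+ m) * s ^+ 2
  - (fps_X + fps_const (2 ^+ m) * fps_X ^+ 2)); first by ring.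
by rewrite sE subrr.
Qed.

(** The compositional inverse of pfister_series m, starting from t/(1 + t). *)
Fixpoint pi_series m : fps int :=
  if m is m'.+1 then fps_comp (pi_series m') (catalan_shift m')
  else fun k => if k is k'.+1 then (-1) ^+ k' else 0.

Lemma pi_series_coef0 m : pi_series m 0%N = 0.
Proof. by elim: m => //= m IHm; rewrite fps_comp_coef0. Qed.

Lemma pi_series_in_L m : in_L (pi_series m).
Proof.
split; first exact: pi_series_coef0.
by elim: m => //= m IHm; rewrite fps_comp_coef1 IHm catalan_shift_coef1.
Qed.

Lemma pfister_series0_geo : (1 - fps_X) * (1 + pfister_series 0) = 1.
Proof.
apply: fpsP => k; rewrite mulrBl mul1r fps_coefB fps_coefXM !fps_coefD.
by case: k => [|[|k]]; rewrite ?fps_coefD !fps_coef1.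
Qed.

Lemma pi_series0_geo : (1 + fps_X) * (1 - pi_series 0) = 1.
Proof.
apply: fpsP => k; rewrite mulrDl mul1r fps_coefD fps_coefXM !fps_coefB.
case: k => [|[|k]]; rewrite ?fps_coefB !fps_coef1 //= exprS; ring.
Qed.

Lemma pfister_pi m : fps_comp (pfister_series m) (pi_series m) = fps_X.
Proof.
elim: m => [|m IHm]; last first.
  rewrite [pfister_series _]/= [pi_series _]/=.
  rewrite -fps_compA ?fps_comp_coef0 ?pfister_series_coef0 ?pi_series_coef0 //.
  rewrite [fps_comp (pfister_series m) _]fps_compA ?pi_series_coef0
    ?catalan_shift_coef0 //.
  by rewrite IHm fps_compXl ?catalan_shift_coef0 ?quad_catalan.
have := congr1 (fun f => fps_comp f (pi_series 0)) pfister_series0_geo.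
rewrite fps_compM // fps_compB fps_compD fps_comp1 fps_compXl //.
set g := fps_comp _ _; set p := pi_series 0 => gE.
have pE := pi_series0_geo; rewrite -/p in pE.
have -> : g = (1 + fps_X) * ((1 - p) * (1 + g)) - 1 :> fps int.
  by rewrite mulrA pE; ring.
by rewrite gE; ring.
Qed.

Lemma pi_pfister m : fps_comp (pi_series m) (pfister_series m) = fps_X.
Proof.
elim: m => [|m IHm]; last first.
  rewrite [pfister_series _]/= [pi_series _]/=.
  rewrite -fps_compA ?fps_comp_coef0 ?catalan_shift_coef0 ?quad_series_coef0 //.
  rewrite [fps_comp (catalan_shift m) _]fps_compA ?pfister_series_coef0
    ?quad_series_coef0 //.
  by rewrite catalan_quad fps_compXl ?pfister_series_coef0.
have := congr1 (fun f => fps_comp f (pfister_series 0)) pi_series0_geo.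
rewrite fps_compM // fps_compB fps_compD fps_comp1 fps_compXl //.
set p := fps_comp _ _; set g := pfister_series 0 => pE.
have gE := pfister_series0_geo; rewrite -/g in gE.
have -> : p = 1 - (1 - fps_X) * (1 + g) * (1 - p) :> fps int.
  by rewrite gE; ring.
by rewrite -mulrA pE; ring.
Qed.

Lemma pi_series_dim m : pfister_dim_le1 m.+1 (pi_series m).
Proof.
move=> R lam lamR x pf_x k k_gt1.
rewrite (alpha_t_pfister _ lamR pf_x) ?(ltnW k_gt1) // pfister_pi.
by case: k k_gt1 => [|[|k]] // _; rewrite /fps_X /= mul0r.
Qed.

Lemma pfister_lambda2 : pfister lambda2 (0, 2).
Proof.
split=> [|d d_gt0].
  rewrite expr2 mulr2n; congr (_, _); rewrite /= ?mulr0 ?addr0 //; ring.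
have := esym_odd_sums 0; rewrite expr1 => odd2E; rewrite /lambda2; congr (_, _).
  rewrite -[LHS](_ : esym_series (odd_sums (0 : algC)) d = _).
    by rewrite esym_odd_sums0 fps_coef1 gtn_eqF.
  by congr (_ d); apply: esym_series_ext => k _; rewrite /odd_sums if_same.
rewrite [LHS](_ : _ = esym_series (odd_sums (2 : algC)) d) // odd2E fps_coefD.
by rewrite fps_coefCM fps_coef1 gtn_eqF // add0r /fps_map /= d_gt0 mulr1.
Qed.

(** The n-fold product of (0, 2) is (0, 2^n), which is not torsion, so that
    dimension at most one makes alpha a right inverse of pfister_series m. *)
Lemma pi_series_uniq m alpha :
  in_L alpha -> pfister_dim_le1 m.+1 alpha -> alpha = pi_series m.
Proof.
move=> [alpha0 alpha1] dim1.
pose two : algC * algC := (0, 2).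
have pfx : n_pfister lambda2 m.+1 (\prod_(i < m.+1) two).
  by exists (fun=> two) => // i; apply: pfister_lambda2.
have x2 : (\prod_(i < m.+1) two).2 = 2 ^+ m.+1.
  by rewrite (rmorph_prod snd) prodr_const card_ord.
have galpha : fps_comp (pfister_series m) alpha = fps_X.
  apply: fpsP => -[|[|k]]; rewrite ?fps_comp_coef0 ?pfister_series_coef0 //.
    by rewrite fps_comp_coef1 pfister_series_coef1 alpha1.
  have := dim1 _ _ lambda2_ring _ pfx k.+2 isT.
  rewrite (alpha_t_pfister _ lambda2_ring pfx) // => /(congr1 snd).
  rewrite (rmorphM snd) (rmorph_int snd) /= x2 => /eqP.
  by rewrite mulf_eq0 expf_eq0 pnatr_eq0 andbF orbF intr_eq0 => /eqP.
rewrite -[LHS]fps_compXl // -(pi_pfister m) -fps_compA ?pfister_series_coef0 //.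
by rewrite galpha fps_compX.
Qed.

(** The formula ((1 + t)/(1 - t))^(2^m) = 1 + 2^(m+1) g without
    denominators. *)
Lemma pfister_series_pow m :
  (1 - fps_X) ^+ (2 ^ m) * (1 + fps_const (2 ^+ m.+1) * pfister_series m) =
  (1 + fps_X) ^+ (2 ^ m).
Proof.
elim: m => [|m IHm].
  rewrite !expr1; have gE := pfister_series0_geo.
  have -> : fps_const 2 = 2 :> fps int by rewrite (fps_constMn _ 2).
  transitivity (2 * ((1 - fps_X) * (1 + pfister_series 0)) - (1 - fps_X)
    : fps int).
    by ring.
  by rewrite gE; ring.
rewrite expnSr !exprM -IHm exprMn; congr (_ * _).
rewrite [pfister_series _]/= comp_quad_series ?pfister_series_coef0 //.
rewrite [2 ^+ m.+2]exprS [2 ^+ m.+1]exprS !fps_constM (fps_constMn _ 2); ring.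
Qed.

(** Substituting pi in the previous identity shows that the 2^m-th power of
    (1 + pi)/(1 - pi) is 1 + 2^(m+1) t, and such a root with constant term 1 is
    unique. *)
Lemma pi_series_explicit m :
  fps_map intr (pi_series m) =
  1 - 2%:R * fps_inv (1 + fps_binpow (2 ^+ m.+1)%R (1 / 2 ^+ m)%R)%R.
Proof.
set S := fps_binpow _ _; set p : fps rat := fps_map intr _.
have S0 : S 0%N = 1.
  by rewrite /S fps_binpow_coef /binomial_series big_ord0 fact0 divr1 mulr1.
have p0 : p 0%N = 0 by rewrite /p /fps_map pi_series_coef0.
have pE : (1 - p) * S = 1 + p.
  apply: (@fps_root_inj _ _ _ m) => //.
  - by rewrite fps_coefM0 S0 fps_coefB fps_coef1 p0 subr0.
  - by rewrite fps_coefD fps_coef1 p0 addr0.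
  rewrite exprMn fps_binpow_root; last first.
    by rewrite natrX; field; rewrite expf_eq0 andbF.
  have := congr1 (fun f => fps_comp f (pi_series m)) (pfister_series_pow m).
  rewrite fps_compM ?pi_series_coef0 // !fps_compXn ?pi_series_coef0 //.
  rewrite fps_compB !fps_compD fps_compM ?pi_series_coef0 // pfister_pi.
  rewrite fps_comp1 fps_compC fps_compXl ?pi_series_coef0 //.
  move/(congr1 (fps_map (intr : int -> rat))).
  rewrite fps_mapM !fps_mapXn fps_mapB !fps_mapD fps_map1 fps_mapM fps_mapC
    fps_mapX.
  by rewrite rmorphXn.
have := @fps_invP _ (1 + S)%R; rewrite fps_coefD fps_coef1 S0 => /(_ isT).
set v := fps_inv _ => Sv.
apply/eqP; rewrite -subr_eq0; apply/eqP.
transitivity ((1 + p - (1 - p) * S) * v + (p - 1) * (1 - (1 + S) * v)).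
  by ring.
by rewrite Sv pE !subrr mul0r mulr0 addr0.
Qed.

Theorem mainTheorem2 :
  (exists pi : nat -> fps int, forall n : nat, (1 <= n)%N ->
    [/\ in_L (pi n) /\ pfister_dim_le1 n (pi n),
        forall alpha : fps int,
          in_L alpha -> pfister_dim_le1 n alpha -> alpha =1 pi n,
        fps_map intr (pi n) =1
          (1%:S - 2%:S * fps_inv (1%:S +
                    fps_binpow (2 ^+ n)%R (1 / 2 ^+ n.-1)%R))%fps,
        pi n.+1 =1
          fps_comp (pi n)
            (fps_X * fps_comp catalan_series
                       ((- 2 ^+ n.-1)%R%:S * fps_X))%fps
      & pi n =1
          fps_comp (pi n.+1) (fps_X + (2 ^+ n.-1)%R%:S * fps_X ^+ 2)%fps])
  /\ (2%:S * fps_X * fps_map intr catalan_series =1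
        1%:S - fps_binpow (- 4)%R (1 / 2)%R)%fps.
Proof.
split; last first.
  by move=> k; have := congr1 (fun f => f k) catalan_sqrt; rewrite -fps_constMn.
exists (fun n => pi_series n.-1) => -[|m] // _; split.
- by split; [apply: pi_series_in_L | apply: pi_series_dim].
- by move=> alpha alphaL dim1; rewrite (pi_series_uniq alphaL dim1).
- move=> k; have := congr1 (fun f => f k) (pi_series_explicit m).
  by rewrite -fps_constMn.
- by [].
move=> k; rewrite -[fps_add _ _]/(quad_series m) [pi_series _.-1]/=.
rewrite -fps_compA ?catalan_shift_coef0 ?quad_series_coef0 //.
by rewrite catalan_quad fps_compX.
Qed.
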